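(* $s(4,3)\ge0.3333429$.
   Context: Write $[n]=\{0,1,\ldots,n-1\}$. A sequence $x\in[n]^3$ covers a sequence $a\in[n]^4$ if $x$ is obtained from $a$ by removing one entry while keeping the order of the remaining entries. A set $C\subseteq[n]^3$ is a covering single-insertion code over $[n]$ if every sequence in $[n]^4$ is covered by at least one sequence in $C$. $S(n,4,3)$ denotes the minimum cardinality of such a code $C\subseteq[n]^3$, and $s(4,3)=\lim_{n\to\infty}S(n,4,3)/n^3$ (this limit exists). *)

(* Defs.v *)
From mathcomp Require Import all_boot all_order all_algebra.
From mathcomp Require Import all_classical all_reals all_analysis.
Set Implicit Arguments.
Unset Strict Implicit.
Unset Printing Implicit Defensive.
Import Order.TTheory GRing.Theory Num.Theory.
Import numFieldNormedType.Exports.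
Local Open Scope ring_scope.

Definition remove_entry (n : nat) (a : 4.-tuple 'I_n) (i : 'I_4) :
  3.-tuple 'I_n := [tuple tnth a (lift i j) | j < 3].

Definition covers (n : nat) (x : 3.-tuple 'I_n) (a : 4.-tuple 'I_n) : bool :=
  [exists i : 'I_4, x == remove_entry a i].

Definition covering_code (n : nat) (C : {set 3.-tuple 'I_n}) : bool :=
  [forall a : 4.-tuple 'I_n, [exists x in C, covers x a]].

Lemma covering_codeT (n : nat) : @covering_code n [set: 3.-tuple 'I_n]%SET.
Proof.
apply/forallP => a; apply/existsP; exists (remove_entry a ord0).
by rewrite finset.in_setT; apply/existsP; exists ord0.
Qed.

(* [arg min] minimizes as intended only if its starting set is itself a
   covering code, which is [covering_codeT]. *)
Definition S43 (n : nat) : nat :=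
  #|[arg min_(C < [set: 3.-tuple 'I_n]%SET | covering_code C) #|C| ]|.

Lemma S43_ex (n : nat) :
  exists2 C : {set 3.-tuple 'I_n}, covering_code C & #|C| = S43 n.
Proof.
rewrite /S43; case: arg_minnP => [|C covC _]; first exact: covering_codeT.
by exists C.
Qed.

Lemma S43_le (n : nat) (C : {set 3.-tuple 'I_n}) :
  covering_code C -> (S43 n <= #|C|)%N.
Proof.
rewrite /S43; case: arg_minnP => [|D _ minD /minD //].
exact: covering_codeT.
Qed.

(* [lim] is total: on a divergent real sequence it is the default point 0, so a
   positive lower bound on [s43 R] is never vacuous.  The term at n = 0 is
   0 / 0 = 0 and does not affect the limit. *)
Definition s43 (R : realType) : R :=
  lim ((fun n : nat => (S43 n)%:R / n%:R ^+ 3 : R) @ \oo)%classic.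

(* Main.v *)
Require Import Defs.
From mathcomp Require Import all_boot all_order all_algebra.
From mathcomp Require Import all_classical all_reals all_analysis.
From mathcomp Require Import zify ring lra.
Set Implicit Arguments.
Unset Strict Implicit.
Unset Printing Implicit Defensive.
Import Order.TTheory GRing.Theory Num.Theory.
Local Open Scope ring_scope.

(** Every covering code C over [n] satisfies 45 |C| >= 16 n^3, so that s(4,3) is
    at least 16/45 = 0.3555..., well above the claimed value.

    Call a triple coded if it lies in C, and let D = |C|.  Among the four
    subtriples of a 4-tuple w, let k(w) be the number of coded ones and A(w) the
    number of pairs of uncoded ones, that is A = 'C(4 - k, 2).  Covering means
    1 <= k(w).
    - Parity.  Each of the ten subtriples of a 5-tuple lies in exactly two of
      its five 4-subtuples, so the five values of k have an even sum and cannot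
      all be odd.  Averaging over 5-tuples, at least n^4 / 5 of the 4-tuples
      have k even ([sum4_even_count]).
    - Convexity.  Two subtriples of w share a pair (u, v), into which each of
      them inserts one letter.  If F0, F1, F2 (depending on u, v) count the
      letters whose insertion before, between and after u and v gives an uncoded
      triple, the sum of A over all w is the sum over (u, v) of
      F0^2 + F1^2 + F2^2 + F0 F1 + F0 F2 + F1 F2.  This quadratic form lies above
      its tangent at F0 = F1 = F2 = 2n/3, and the F's sum to n^3 - D each; hence
      the sum of A is at least 16/3 n^4 - 8 n D ([sum4_noncode_pairs]).
    - For k = 1, 2, 3, 4 one has 2 A + k + 3 [k even] <= 7, with equality unless
      k = 3 ([noncode_pairs_le]).  Summing over w, where k sums to 4 n D, gives the
      bound ([sum3_lower_bound]).

    Since the limit is a total operation, its existence has to be proved as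
    well.  Pulling a code over [n] back along x |-> x mod n gives
    S(m) <= S(n) k^3 whenever m <= k n ([S43_blowup]), so the sequence
    S(n) / n^3 converges to its infimum over n >= 1. *)

(** * Counting over 4-tuples *)

Section Counting.
Local Open Scope nat_scope.
Variables (T : finType) (P : T -> T -> T -> bool).

Let N := #|T|.

(** The number of subtriples of (a, b, c, d) that satisfy P; P is the
    membership predicate of the code. *)
Definition code_count a b c d : nat := P b c d + P a c d + P a b d + P a b c.

(** The number of unordered pairs of positions whose removal leaves, in both
    cases, a subtriple outside P.  The terms are ordered as
    F0^2, F1^2, F2^2, F0 F1, F0 F2, F1 F2 according to the slots (before,
    between, after) where the two subtriples insert a letter into the pair that
    they share. *)
Definition noncode_pairs a b c d : nat :=
  let q x y z := nat_of_bool (~~ P x y z) in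
    q a c d * q b c d + q a b d * q a c d + q a b c * q a b d
  + q a b d * q b c d + q a b c * q b c d + q a b c * q a c d.

(** The indicator of the 4-tuples with an even number of subtriples in P. *)
Definition even_count a b c d : nat := ~~ odd (code_count a b c d).

(** Each triple lies in two of the five 4-subtuples, so the five counts cannot
    all be odd. *)
Lemma even_count_5tuple a b c d e :
  0 < even_count b c d e + even_count a c d e + even_count a b d e
      + even_count a b c e + even_count a b c d.
Proof.
rewrite /even_count /code_count !oddD !oddb.
by case: (P a b c) (P a b d) (P a b e) (P a c d) (P a c e) (P a d e)
  (P b c d) (P b c e) (P b d e) (P c d e) => [] [] [] [] [] [] [] [] [] [].
Qed.

Lemma noncode_pairs_le a b c d : 0 < code_count a b c d ->
  2 * noncode_pairs a b c d + code_count a b c d + 3 * even_count a b c d <= 7.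
Proof.
rewrite /even_count /noncode_pairs /code_count.
by case: (P a b c) (P a b d) (P a c d) (P b c d) => [] [] [] [].
Qed.

(** Sums over all pairs, triples, 4-tuples and 5-tuples of letters, as iterated
    sums.  A lemma [sumk_skipi] sums a function that ignores its i-th argument,
    [sumk_swapij] exchanges the i-th and j-th summation variables. *)
Definition sum2 (f : T -> T -> nat) := \sum_a \sum_b f a b.
Definition sum3 f := \sum_(a : T) sum2 (f a).
Definition sum4 f := \sum_(a : T) sum3 (f a).
Definition sum5 f := \sum_(a : T) sum4 (f a).

Lemma sum2D f g : sum2 (fun a b => f a b + g a b) = sum2 f + sum2 g.
Proof. by rewrite -big_split; apply: eq_bigr => a _; rewrite -big_split. Qed.

Lemma sum3D f g : sum3 (fun a b c => f a b c + g a b c) = sum3 f + sum3 g.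
Proof. by rewrite -big_split; apply: eq_bigr => a _; apply: sum2D. Qed.

Lemma sum4D f g :
  sum4 (fun a b c d => f a b c d + g a b c d) = sum4 f + sum4 g.
Proof. by rewrite -big_split; apply: eq_bigr => a _; apply: sum3D. Qed.

Lemma sum5D f g :
  sum5 (fun a b c d e => f a b c d e + g a b c d e) = sum5 f + sum5 g.
Proof. by rewrite -big_split; apply: eq_bigr => a _; apply: sum4D. Qed.

Lemma sum2Z m f : sum2 (fun a b => m * f a b) = m * sum2 f.
Proof. by rewrite big_distrr; apply: eq_bigr => a _; rewrite big_distrr. Qed.

Lemma sum4Z m f : sum4 (fun a b c d => m * f a b c d) = m * sum4 f.
Proof.
rewrite big_distrr; apply: eq_bigr => a _; rewrite big_distrr.
by apply: eq_bigr => b _; apply: sum2Z.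
Qed.

Lemma sum3_skip1 f : sum3 (fun _ => f) = N * sum2 f.
Proof. exact: sum_nat_const. Qed.

Lemma sum3_skip2 f : sum3 (fun a _ => f a) = N * sum2 f.
Proof. by rewrite big_distrr; apply: eq_bigr => a _; apply: sum_nat_const. Qed.

Lemma sum3_skip3 f : sum3 (fun a b _ => f a b) = N * sum2 f.
Proof.
rewrite -sum2Z; do 2!apply: eq_bigr => ? _; exact: sum_nat_const.
Qed.

Lemma sum4_skip1 f : sum4 (fun _ => f) = N * sum3 f.
Proof. exact: sum_nat_const. Qed.

Lemma sum4_skip2 f : sum4 (fun a _ => f a) = N * sum3 f.
Proof. by rewrite big_distrr; apply: eq_bigr => a _; apply: sum3_skip1. Qed.

Lemma sum4_skip3 f : sum4 (fun a b _ => f a b) = N * sum3 f.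
Proof. by rewrite big_distrr; apply: eq_bigr => a _; apply: sum3_skip2. Qed.

Lemma sum4_skip4 f : sum4 (fun a b c _ => f a b c) = N * sum3 f.
Proof. by rewrite big_distrr; apply: eq_bigr => a _; apply: sum3_skip3. Qed.

Lemma sum5_skip1 f : sum5 (fun _ => f) = N * sum4 f.
Proof. exact: sum_nat_const. Qed.

Lemma sum5_skip2 f : sum5 (fun a _ => f a) = N * sum4 f.
Proof. by rewrite big_distrr; apply: eq_bigr => a _; apply: sum4_skip1. Qed.

Lemma sum5_skip3 f : sum5 (fun a b _ => f a b) = N * sum4 f.
Proof. by rewrite big_distrr; apply: eq_bigr => a _; apply: sum4_skip2. Qed.

Lemma sum5_skip4 f : sum5 (fun a b c _ => f a b c) = N * sum4 f.
Proof. by rewrite big_distrr; apply: eq_bigr => a _; apply: sum4_skip3. Qed.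

Lemma sum5_skip5 f : sum5 (fun a b c d _ => f a b c d) = N * sum4 f.
Proof. by rewrite big_distrr; apply: eq_bigr => a _; apply: sum4_skip4. Qed.

Lemma sum2_const m : sum2 (fun _ _ => m) = N ^ 2 * m.
Proof. by rewrite /sum2 !sum_nat_const mulnA. Qed.

Lemma sum3_const m : sum3 (fun _ _ _ => m) = N ^ 3 * m.
Proof. by rewrite sum3_skip1 sum2_const mulnA. Qed.

Lemma sum4_const m : sum4 (fun _ _ _ _ => m) = N ^ 4 * m.
Proof. by rewrite sum4_skip1 sum3_const mulnA. Qed.

Lemma leq_sum2 f g : (forall a b, f a b <= g a b) -> sum2 f <= sum2 g.
Proof. by move=> le_fg; do 2!apply: leq_sum => ? _. Qed.

Lemma leq_sum4 f g : (forall a b c d, f a b c d <= g a b c d) ->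
  sum4 f <= sum4 g.
Proof. by move=> le_fg; do 4!apply: leq_sum => ? _. Qed.

Lemma leq_sum5 f g : (forall a b c d e, f a b c d e <= g a b c d e) ->
  sum5 f <= sum5 g.
Proof. by move=> le_fg; do 5!apply: leq_sum => ? _. Qed.

Lemma sum4_swap12 f : sum4 f = sum4 (fun a b c d => f b a c d).
Proof. exact: exchange_big. Qed.

Lemma sum4_swap23 f : sum4 f = sum4 (fun a b c d => f a c b d).
Proof. by apply: eq_bigr => a _; apply: exchange_big. Qed.

Lemma sum4_swap34 f : sum4 f = sum4 (fun a b c d => f a b d c).
Proof. by do 2!apply: eq_bigr => ? _; apply: exchange_big. Qed.

Lemma sum3_swap12 f : sum3 f = sum3 (fun a b c => f b a c).
Proof. exact: exchange_big. Qed.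

Lemma sum3_swap23 f : sum3 f = sum3 (fun a b c => f a c b).
Proof. by apply: eq_bigr => a _; apply: exchange_big. Qed.

Lemma sum4_code_count :
  sum4 code_count = 4 * N * sum3 (fun a b c => P a b c).
Proof.
by rewrite /code_count !sum4D sum4_skip1 sum4_skip2 sum4_skip3 sum4_skip4; lia.
Qed.

Lemma sum4_even_count : N ^ 4 <= 5 * sum4 even_count.
Proof.
have [N0|N_gt0] := posnP N; first by rewrite N0.
rewrite -(leq_pmul2l N_gt0).
have -> : N * N ^ 4 = sum5 (fun _ _ _ _ _ => 1).
  by rewrite sum5_skip1 sum4_const muln1.
apply: leq_trans (leq_sum5 even_count_5tuple) _.
rewrite !sum5D sum5_skip1 sum5_skip2 sum5_skip3 sum5_skip4 sum5_skip5.
by move: (sum4 even_count) => z; nia.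
Qed.

Lemma sum2M (f g : T -> T -> T -> nat) :
  sum2 (fun u v => (\sum_x f u v x) * (\sum_y g u v y)) =
  sum4 (fun u v x y => f u v x * g u v y).
Proof. by do 2!apply: eq_bigr => ? _; rewrite big_distrlr. Qed.

(** The difference of the two sides is 2 (x + y + z - 2 n)^2 plus half the sum
    of the squares of x - y, x - z and y - z. *)
Lemma quadratic_tangent n x y z : 8 * n * (x + y + z) <=
  3 * (x * x + y * y + z * z + x * y + x * z + y * z) + 8 * n ^ 2.
Proof.
rewrite -(ler_nat rat) !(natrD, natrM, natrX).
move: x%:R%R y%:R%R z%:R%R n%:R%R => {}x {}y {}z {}n.
rewrite -subr_ge0.
have := sqr_ge0 (x + y + z - 2 * n)%R.
have := sqr_ge0 (x - y)%R; have := sqr_ge0 (x - z)%R.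
have := sqr_ge0 (y - z)%R.
by move=> yz xz xy s; nra.
Qed.

(** The sum of [noncode_pairs] is at least 16/3 N^4 - 8 N D, where D is the
    number of triples in P. *)
Lemma sum4_noncode_pairs :
  16 * N ^ 4 <= 3 * sum4 noncode_pairs + 24 * N * sum3 (fun a b c => P a b c).
Proof.
pose q x y z := nat_of_bool (~~ P x y z).
have PD : sum3 (fun a b c => P a b c) + sum3 q = N ^ 3.
  rewrite -sum3D -[RHS]muln1 -sum3_const; do 3!apply: eq_bigr => ? _.
  by rewrite /q; case: P.
pose F0 u v := \sum_x q x u v.
pose F1 u v := \sum_x q u x v.
pose F2 u v := \sum_x q u v x.
have sF0 : sum2 F0 = sum3 q.
  by rewrite [RHS]sum3_swap12 sum3_swap23.
have sF1 : sum2 F1 = sum3 q by rewrite sum3_swap23.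
have -> : sum4 noncode_pairs = sum2 (fun u v =>
    F0 u v * F0 u v + F1 u v * F1 u v + F2 u v * F2 u v
    + F0 u v * F1 u v + F0 u v * F2 u v + F1 u v * F2 u v).
  rewrite !sum2D !sum2M !sum4D; do 5?congr (_ + _) => //.
  (* The term in F2^2 is closed by conversion; in each of the others the
     variables u, v, x, y are moved to their positions in the 4-tuple. *)
  - by rewrite [RHS]sum4_swap23 [RHS]sum4_swap12 [RHS]sum4_swap34
               [RHS]sum4_swap23.
  - by rewrite [RHS]sum4_swap23 [RHS]sum4_swap34.
  - by rewrite [RHS]sum4_swap23 [RHS]sum4_swap12 [RHS]sum4_swap34.
  - by rewrite [RHS]sum4_swap23 [RHS]sum4_swap12.
  - by rewrite [RHS]sum4_swap23.
have := leq_sum2 (fun u v => quadratic_tangent N (F0 u v) (F1 u v) (F2 u v)).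
rewrite sum2D sum2_const !sum2Z !(sum2D _ F2) (sum2D F0) sF0 sF1.
rewrite -[sum2 F2]/(sum3 q).
move: (sum2 _) (sum3 _) (sum3 q) PD => X D Q PD; rewrite !expnS expn0 in PD *.
nia.
Qed.

Lemma sum3_lower_bound : (forall a b c d, 0 < code_count a b c d) ->
  16 * N ^ 3 <= 45 * sum3 (fun a b c => P a b c).
Proof.
have [N0|N_gt0] := posnP N; first by rewrite N0.
move=> cov; rewrite -(leq_pmul2l N_gt0).
have := leq_sum4 (fun a b c d => noncode_pairs_le (cov a b c d)).
rewrite sum4_const 2!sum4D !sum4Z.
have := sum4_noncode_pairs; have := sum4_even_count; rewrite sum4_code_count.
move: (sum4 _) (sum4 _) (sum3 _) => X D Q.
rewrite !expnS expn0; nia.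
Qed.

End Counting.

(** * From codes to the counting bound *)

Section Codes.
Local Open Scope nat_scope.

(** Membership of the triple (a, b, c) in C. *)
Definition in_code n (C : {set 3.-tuple 'I_n}) (a b c : 'I_n) : bool :=
  [tuple a; b; c] \in C.

Lemma sum3_in_code n (C : {set 3.-tuple 'I_n}) :
  sum3 (fun a b c => in_code C a b c) = #|C|.
Proof.
rewrite /sum3 /sum2.
under eq_bigr do rewrite pair_bigA.
rewrite pair_bigA /= -sum1_card [RHS]big_mkcond /=.
rewrite [RHS](reindex (fun u : 'I_n * ('I_n * 'I_n) =>
  [tuple u.1; u.2.1; u.2.2])) /=.
  by apply: eq_bigr => u _; rewrite /in_code; case: (_ \in C).
exists (fun t => (tnth t ord0, (tnth t (inord 1), tnth t (inord 2)))) => [] /=.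
  by case=> a [b c] _; rewrite !(tnth_nth a) /= !inordK.
case=> [[|a [|b [|c [|]]]] // st] _; apply: val_inj.
by rewrite /= !(tnth_nth a) /= !inordK.
Qed.

Lemma covering_code_count n (C : {set 3.-tuple 'I_n}) : covering_code C ->
  forall a b c d, 0 < code_count (in_code C) a b c d.
Proof.
move=> /forallP covC a b c d.
have /existsP[x /andP[xC /existsP[i /eqP xE]]] := covC [tuple a; b; c; d].
have rE : [|| in_code C b c d, in_code C a c d, in_code C a b d
            | in_code C a b c].
  have eE (u v w : 'I_n) : remove_entry [tuple a; b; c; d] i = [tuple u; v; w]
      -> in_code C u v w.
    by move=> E; rewrite /in_code -E -xE.
  case: i {xE} eE => [[|[|[|[|]]]] // i4] eE;
    [apply/or4P/Or41/eE | apply/or4P/Or42/eE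
    | apply/or4P/Or43/eE | apply/or4P/Or44/eE];
  by apply: eq_from_tnth => -[[|[|[|]]] // j3];
    rewrite tnth_mktuple !(tnth_nth a).
by move: rE; rewrite /code_count; do 4!case: in_code.
Qed.

Lemma S43_lower_bound n : 16 * n ^ 3 <= 45 * S43 n.
Proof.
have [C covC <-] := S43_ex n; rewrite -(sum3_in_code C) -{1}(card_ord n).
exact/sum3_lower_bound/covering_code_count.
Qed.

(** * Existence of the limit *)

Lemma remove_entry_map m n (f : 'I_m -> 'I_n) (a : 4.-tuple 'I_m) i :
  remove_entry (map_tuple f a) i = map_tuple f (remove_entry a i).
Proof. by apply: eq_from_tnth => j; rewrite !(tnth_mktuple, tnth_map). Qed.

Lemma covering_code_preim m n (f : 'I_m -> 'I_n) (C : {set 3.-tuple 'I_n}) :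
  covering_code C -> covering_code (map_tuple f @^-1: C).
Proof.
move=> /forallP covC; apply/forallP => a.
have /existsP[x /andP[xC /existsP[i /eqP xE]]] := covC (map_tuple f a).
apply/existsP; exists (remove_entry a i); rewrite inE -remove_entry_map -xE xC.
by apply/existsP; exists i.
Qed.

(** The code over [m] is the preimage of an optimal code C over [n] under
    reduction mod n; a triple in it is determined by its residues, which form an
    element of C, and by its quotients by n, which are smaller than k. *)
Lemma S43_blowup m n k : m <= k * n -> S43 m <= S43 n * k ^ 3.
Proof.
move=> le_m_kn; have [C covC <-] := S43_ex n.
have n_gt0 (x : 'I_m) : 0 < n by case: n le_m_kn {C covC} => // ; case: x; lia.
pose f x := Ordinal (ltn_pmod (nat_of_ord x) (n_gt0 x)).
have ltk (x : 'I_m) : x %/ n < k.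
  by rewrite ltn_divLR ?(n_gt0 x)//; apply: leq_trans (ltn_ord x) le_m_kn.
pose g x := Ordinal (ltk x).
pose h (t : 3.-tuple 'I_m) := (map_tuple f t, map_tuple g t).
have h_inj : injective h.
  move=> s t hst; apply: eq_from_tnth => j; apply: val_inj.
  rewrite /= (divn_eq (tnth s j) n) (divn_eq (tnth t j) n).
  have := congr1 (fun u => (val (tnth u.1 j), val (tnth u.2 j))) hst.
  by rewrite /h /= !tnth_map /= => -[-> ->].
apply: leq_trans (S43_le (covering_code_preim f covC)) _.
rewrite -(card_imset _ h_inj).
have -> : #|C| * k ^ 3 = #|finset.setX C [set: 3.-tuple 'I_k]%SET|.
  by rewrite cardsX cardsT card_tuple card_ord.
apply/subset_leq_card/fintype.subsetP => _ /imsetP[t + ->].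
by rewrite !inE /= => ->.
Qed.

Lemma S43_le_cube n : S43 n <= n ^ 3.
Proof.
have := S43_le (covering_codeT n).
by rewrite cardsT card_tuple card_ord.
Qed.

End Codes.

Section Limit.
Import numFieldNormedType.Exports.
Variable R : realType.

(** The sequence whose limit is [s43]. *)
Definition S43_density n : R := (S43 n)%:R / n%:R ^+ 3.

Lemma S43_density_ge n : (0 < n)%N -> 16 / 45 <= S43_density n.
Proof.
move=> n_gt0; have n3 : (0 : R) < n%:R ^+ 3 by rewrite exprn_gt0 ?ltr0n.
rewrite ler_pdivlMr // -natrX.
have := S43_lower_bound n; rewrite -(ler_nat R) !natrM; lra.
Qed.

(** With k = m %/ n + 1 in [S43_blowup], the density grows by a factor of at
    most (1 + t)^3 <= 1 + 7 t, where t = n / m. *)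
Lemma S43_density_le m n : (0 < n)%N -> (n <= m)%N ->
  S43_density m <= S43_density n + 7 * n%:R / m%:R.
Proof.
move=> n_gt0 le_nm; have m_gt0 := leq_trans n_gt0 le_nm.
have n0 : (0 : R) < n%:R by rewrite ltr0n.
have m0 : (0 : R) < m%:R by rewrite ltr0n.
set t : R := n%:R / m%:R.
have t01 : 0 < t <= 1 by rewrite divr_gt0 //= ler_pdivrMr // mul1r ler_nat.
have u1 : S43_density n <= 1.
  by rewrite ler_pdivrMr ?exprn_gt0 // mul1r -natrX ler_nat S43_le_cube.
have u0 : 0 <= S43_density n by rewrite divr_ge0 ?exprn_ge0.
have kE : ((m %/ n).+1%:R : R) <= m%:R / n%:R * (1 + t).
  rewrite /t mulrDr mulr1 mulrA divfK ?gt_eqF // divff ?gt_eqF //.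
  by rewrite -natr1 lerD2r ler_pdivlMr // -natrM ler_nat leq_divM.
have Sm : S43_density m <= S43_density n * (1 + t) ^+ 3.
  have := @S43_blowup m n (m %/ n).+1 (ltnW (ltn_ceil m n_gt0)).
  rewrite -(ler_nat R) natrM natrX => Sm.
  rewrite ler_pdivrMr ?exprn_gt0 //; apply: le_trans Sm _.
  apply: (@le_trans _ _ ((S43 n)%:R * (m%:R / n%:R * (1 + t)) ^+ 3)).
    by rewrite ler_wpM2l // lerXn2r // nnegrE ?(le_trans _ kE).
  by rewrite /S43_density !exprMn exprVn le_eqVlt; apply/orP; left; apply/eqP;
    ring.
apply: le_trans Sm _; rewrite -mulrA -/t.
have t3 : (1 + t) ^+ 3 <= 1 + 7 * t.
  have -> : (1 + t) ^+ 3 = 1 + 3 * t + 3 * (t * t) + t * (t * t) by ring.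
  nra.
nra.
Qed.

(** The limit is the infimum of the densities over n >= 1. *)
Lemma cvg_S43_density : cvgn S43_density.
Proof.
pose A := [set S43_density n | n in [set n | (0 < n)%N]]%classic.
have A1 : A (S43_density 1) by exists 1%N.
have lbA : has_inf A.
  split; first by exists (S43_density 1).
  by exists (16 / 45) => _ [n /= n_gt0 <-]; apply: S43_density_ge.
apply/cvg_ex; exists (inf A); apply/cvgrPdist_le => /= e e0.
have e2 : 0 < e / 2 by lra.
have [_ [n /= n_gt0 <-] un] := inf_adherent e2 lbA.
near=> m.
have m_gt0 : (0 < m)%N by near: m; exists 1%N.
have le_nm : (n <= m)%N by near: m; exists n.
have um : inf A <= S43_density m.
  by apply: ge_inf; [exact: lbA.2|exists m].
have tm : 7 * n%:R / m%:R <= e / 2.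
  rewrite ler_pdivrMr ?ltr0n // [e / 2 * _]mulrC -ler_pdivrMr //.
  by near: m; exact: nbhs_infty_ger.
have := S43_density_le n_gt0 le_nm.
rewrite distrC ger0_norm; lra.
Unshelve. all: by end_near. Qed.

End Limit.

Theorem corollary17 (R : realType) : 3333429%:R / 10 ^+ 7 <= s43 R.
Proof.
apply: (@le_trans _ _ (16 / 45)).
  by rewrite ler_pdivrMr ?exprn_gt0 //; lra.
apply: limr_ge; first exact: cvg_S43_density.
by near=> n; apply: S43_density_ge; near: n; exists 1%N.
Unshelve. all: by end_near. Qed.
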